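(* Let $T\ge 1$. For all integers $N\ge 1$ and all $\Delta t>0$ with $N\Delta t\le T$, the solution $(\bm{\sigma}^-,\bm{\sigma}^+)$ of the forward Euler system $$\begin{bmatrix} -\tfrac12 I & V\\ V & -\tfrac12 I\end{bmatrix}\begin{bmatrix}\bm{\sigma}^-\\ \bm{\sigma}^+\end{bmatrix}=\begin{bmatrix}\bm{f}^-\\ \bm{f}^+\end{bmatrix}$$ (with $V$ defined in the context) satisfies $$\|[\bm{\sigma}^-,\bm{\sigma}^+]\|\;\le\; e\sqrt{\pi T}\,\|[\bm{f}^-,\bm{f}^+]\| .$$ That is, for the unit ball in dimension $d=1$, with boundary $\{-1,1\}$, the forward Euler scheme for the double-layer second-kind Volterra integral equation of the Dirichlet problem for the heat equation is unconditionally stable on any finite time interval $[0,T]$.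
   Context: $\bm{\sigma}^\pm=\{\sigma^\pm_j\}_{j=0}^N$ and $\bm{f}^\pm=\{f^\pm_j\}_{j=0}^N$ are vectors in $\mathbb{R}^{N+1}$ (density and boundary data at the boundary points $\pm1$ at times $t_j=j\Delta t$, with the initialization convention $f_0^\pm=0$, $\sigma_0^\pm=0$); $I$ is the $(N+1)\times(N+1)$ identity matrix; $\|\cdot\|$ is the $\ell^2$-norm on $\mathbb{R}^{2(N+1)}$. $V\in\mathbb{R}^{(N+1)\times(N+1)}$ is the strictly lower-triangular Toeplitz matrix with entries $V_{jk}=v_{j-k}$ for $j>k$ and $V_{jk}=0$ for $j\le k$ ($0\le j,k\le N$), where $$v_l=-\int_0^{\Delta t}\gamma(l\Delta t-\tau)\,d\tau\quad (l\ge 1),\qquad \gamma(t)=\frac{1}{2\sqrt{\pi}}\,t^{-3/2}e^{-1/t}\quad (t>0).$$ This is the discretization of $(-\tfrac12+\mathcal{D})[\sigma]=f$ on $\{-1,1\}\times[0,T]$, with $\mathcal{D}$ the double layer heat potential, obtained by taking the density piecewise constant in time, equal to $\sigma_j^\pm$ on $[j\Delta t,(j+1)\Delta t)$, and integrating the kernel exactly in time. *)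

(* Defs.v *)
(* MathComp-Analysis *)
From HB Require Import structures.
From mathcomp Require Import all_boot all_order all_algebra.
From mathcomp Require Import all_classical all_reals all_analysis.

Set Implicit Arguments.
Unset Strict Implicit.
Unset Printing Implicit Defensive.

Import Order.TTheory GRing.Theory Num.Theory.
Import numFieldNormedType.Exports.

Local Open Scope classical_set_scope.
Local Open Scope ring_scope.

(* Only meaningful for 0 < t; by the conventions [0 `^ x = 0] for [x != 0] and
   [0^-1 = 0], the value at t = 0 is 0, which is also the limit as t -> 0+. *)
Definition heat_kernel {R : realType} (t : R) : R :=
  (2 * Num.sqrt pi)^-1 * t `^ (- (3 / 2)) * expR (- t^-1).

(* For l = 1 the integrand reaches [heat_kernel 0] at the endpoint tau = dt. *)
Definition euler_weight {R : realType} (dt : R) (l : nat) : R :=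
  - \int[@lebesgue_measure R]_(tau in `[0, dt]) heat_kernel (l%:R * dt - tau).

Definition euler_mx {R : realType} (N : nat) (dt : R) : 'M[R]_N.+1 :=
  \matrix_(j < N.+1, k < N.+1)
    if (k < j)%N then euler_weight dt (j - k)%N else 0.

(* The library norm [`|x|] on matrices is the sup norm. *)
Definition l2norm {R : realType} (n : nat) (x : 'cV[R]_n) : R :=
  Num.sqrt (\sum_(i < n) x i 0 ^+ 2).

(* Main.v *)
(** With w_l = - v_l >= 0, the sums of the entries of -V along any row or column
    are at most the sum of w_l for 1 <= l <= N, which is the integral of gamma
    over [0, N dt].  The substitution u = t^(-1/2) turns this into
    1/2 - (1/sqrt pi) * int_0^((N dt)^(-1/2)) e^(-u^2) du, because the Gaussian
    integral makes the total mass of gamma 1/2.  As N dt <= T and 1 <= T,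
    it is at most 1/2 - c with c = 1 / (e sqrt(pi T)).  Pairing the system with
    sigma and using Schur's bound for the quadratic form of V gives
    c |sigma|^2 <= |<sigma, f>|, hence c |sigma| <= |f|. *)
Require Import Defs.
From HB Require Import structures.
From mathcomp Require Import all_boot all_order all_algebra.
From mathcomp Require Import all_classical all_reals all_analysis.
From mathcomp Require Import ring lra.
Import Order.TTheory GRing.Theory Num.Theory.
Import numFieldNormedType.Exports gauss_integral_proof.
Local Open Scope ring_scope.

Local Notation mu := lebesgue_measure.

(** * The Gaussian integral: derivative, limit and a lower bound *)

Lemma integrable_gauss_itv {R : realType} (x : R) :
  mu.-integrable `[0, x] (EFin \o @gauss_fun R).
Proof.
apply: continuous_compact_integrable; first exact: segment_compact.
by apply: continuous_subspaceT; exact: continuous_gauss_fun.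
Qed.

Lemma is_derive_integral0_gauss {R : realType} (x : R) : 0 < x ->
  is_derive x 1 (@integral0_gauss R) (gauss_fun x).
Proof.
move=> x0.
(* The endpoint [x + 1] serves to make [x] an interior point. *)
have [] := @continuous_FTC1_closed R _ 0 x (x + 1) _ (integrable_gauss_itv _)
  x0 (@continuous_gauss_fun R x); first by rewrite ltrDl.
by rewrite derive1E; exact: DeriveDef.
Qed.

(** The square tends to pi / 4, and the root can be taken because the integral is nonnegative. *)
Lemma cvg_integral0_gauss {R : realType} :
  (@integral0_gauss R x @[x --> +oo] --> Num.sqrt pi / 2)%classic.
Proof.
have -> : Num.sqrt pi / 2 = Num.sqrt (pi / 4) :> R.
  rewrite sqrtrM ?pi_ge0// sqrtrV// (_ : 4 = 2 ^+ 2 :> R).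
    by rewrite sqrtr_sqr ger0_norm.
  by rewrite expr2 -natrM.
rewrite (_ : integral0_gauss = fun x : R => Num.sqrt (integral0_gauss x ^+ 2)).
  apply: continuous_cvg; first exact: sqrt_continuous.
  exact: cvg_integral0_gauss_sqr.
by apply/funext => x; rewrite sqrtr_sqr ger0_norm// integral0_gauss_ge0.
Qed.

(** On [0, y] the integrand e^(-t^2) is at least e^(-1), as y <= 1. The factor e of the final bound
    comes from here. *)
Lemma integral0_gauss_ge_expN1 {R : realType} (x y : R) :
  0 <= y -> y <= 1 -> y <= x -> y / expR 1 <= integral0_gauss x.
Proof.
move=> y0 y1 yx.
have le_yx : integral0_gauss y <= integral0_gauss x.
  rewrite /integral0_gauss /Rintegral fine_le//.
  - exact: integrable_fin_num (integrable_gauss_itv _).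
  - exact: integrable_fin_num (integrable_gauss_itv _).
  apply: ge0_subset_integral => //=.
  - by have /integrableP[] := integrable_gauss_itv x.
  - by move=> ? _; rewrite lee_fin gauss_fun_ge0.
  - by apply: subset_itvl; rewrite bnd_simp.
apply: le_trans le_yx.
have -> : y / expR 1 = \int[mu]_(t in `[0, y]) cst (expR 1)^-1 t.
  rewrite Rintegral_cst//= lebesgue_measure_itv/= lte_fin.
  case: ltP => [_|y_le0]; first by rewrite oppr0 addr0 mulrC.
  by rewrite (le_anti (introT andP (conj y_le0 y0))) mul0r mulr0.
apply: le_Rintegral => //=.
- apply: continuous_compact_integrable; first exact: segment_compact.
  by apply: continuous_subspaceT => z; exact: cvg_cst.
- exact: integrable_gauss_itv.
move=> t; rewrite in_itv/= => /andP[t0 ty].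
by rewrite /gauss_fun -expRN ler_expR lerN2 expr_le1// (le_trans ty).
Qed.

(** * The kernel gamma and its continuous extension by zero *)

Lemma heat_kernel_ge0 {R : realType} (t : R) : 0 <= heat_kernel t.
Proof.
by rewrite /heat_kernel !mulr_ge0 ?expR_ge0 ?powR_ge0// invr_ge0 mulr_ge0
  ?sqrtr_ge0.
Qed.

(** Since e^(-1/t) <= 4 t^2, the factor t^(-3/2) becomes t^(1/2); this forces the limit 0 at 0 from
    the right. *)
Lemma heat_kernel_le_sqrt {R : realType} (t : R) : 0 < t ->
  heat_kernel t <= 2 / Num.sqrt pi * Num.sqrt t.
Proof.
rewrite /heat_kernel => t0.
have p0 : 0 < Num.sqrt pi :> R by rewrite sqrtr_gt0 pi_gt0.
have -> : t `^ (- (3 / 2)) = Num.sqrt t * (t ^+ 2)^-1.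
  rewrite -powR12_sqrt ?ltW// -powR_mulrn ?ltW// -powRN -powRD.
    by congr (_ `^ _); field.
  by apply/implyP => _; rewrite gt_eqF.
(* [e^(1/t) >= (1 + 1/(2t))^2] *)
have e4 : (t ^+ 2)^-1 * expR (- t^-1) <= 4.
  rewrite expRN ler_pdivrMr ?expR_gt0//.
  have -> : t^-1 = 2^-1 * t^-1 + 2^-1 * t^-1 by field; rewrite gt_eqF.
  have h := expR_ge1Dx (2^-1 * t^-1).
  have s0 : 0 < t^-1 by rewrite invr_gt0.
  rewrite expRD -exprVn; nra.
rewrite invfM.
have -> : 2^-1 / Num.sqrt pi * (Num.sqrt t / t ^+ 2) * expR (- t^-1) =
  (2^-1 / Num.sqrt pi * Num.sqrt t) * ((t ^+ 2)^-1 * expR (- t^-1)).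
  by ring.
have -> : 2 / Num.sqrt pi * Num.sqrt t =
  (2^-1 / Num.sqrt pi * Num.sqrt t) * 4 by field; rewrite gt_eqF.
by rewrite ler_pM2l// mulr_gt0 ?sqrtr_gt0// divr_gt0.
Qed.

(* [heat_kernel] itself is unbounded to the left of 0. *)
Definition heat_kernel_pos {R : realType} (t : R) : R :=
  if t <= 0 then 0 else heat_kernel t.

Lemma heat_kernel_pos_le0 {R : realType} (t : R) :
  t <= 0 -> heat_kernel_pos t = 0.
Proof. by rewrite /heat_kernel_pos => ->. Qed.

Lemma heat_kernel_pos_gt0 {R : realType} (t : R) : 0 < t ->
  heat_kernel_pos t = heat_kernel t.
Proof. by move=> t0; rewrite /heat_kernel_pos leNgt t0. Qed.

Lemma derivable_heat_kernel {R : realType} (t : R) : 0 < t ->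
  derivable (@heat_kernel R) t 1.
Proof.
move=> t0; rewrite /heat_kernel; apply: derivableM; first apply: derivableM.
- exact: derivable_cst.
- by apply: derivable_powR; rewrite in_itv/= t0.
have dV : derivable (fun x : R => - x^-1) t 1.
  by apply: derivableN; apply: derivableV; rewrite ?gt_eqF.
apply/derivable1_diffP.
apply: (@differentiable_comp _ _ _ _ (fun x : R => - x^-1) expR).
  exact/derivable1_diffP.
exact/derivable1_diffP/derivable_expR.
Qed.

Lemma continuous_heat_kernel_pos {R : realType} :
  continuous (@heat_kernel_pos R).
Proof.
move=> t; have [t0|t0|->] := ltgtP t 0.
- rewrite /continuous_at (heat_kernel_pos_le0 _ (ltW t0)).
  have : ((0 : R) @[_ --> t] --> (0 : R))%classic by exact: cvg_cst.
  apply: cvg_trans; apply: near_eq_cvg.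
  near=> x; rewrite heat_kernel_pos_le0// ltW//.
  by near: x; exact: lt_nbhsl.
- rewrite /continuous_at heat_kernel_pos_gt0//.
  have : {for t, continuous (@heat_kernel R)}.
    exact/differentiable_continuous/derivable1_diffP/derivable_heat_kernel.
  apply: cvg_trans; apply: near_eq_cvg.
  near=> x; rewrite heat_kernel_pos_gt0//.
  by near: x; exact: lt_nbhsr.
- rewrite /continuous_at (heat_kernel_pos_le0 _ (lexx _)).
  apply: (@squeeze_cvgr _ _ _ _ (cst 0)
    (fun x => 2 / Num.sqrt pi * Num.sqrt x)).
  + near=> x; rewrite /=; case: (leP x 0) => [x0|x0].
      by rewrite heat_kernel_pos_le0// lexx mulr_ge0 ?sqrtr_ge0// divr_ge0
        ?sqrtr_ge0.
    by rewrite heat_kernel_pos_gt0// heat_kernel_ge0 heat_kernel_le_sqrt.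
  + exact: cvg_cst.
  + rewrite -[X in (_ --> X)%classic](mulr0 (2 / Num.sqrt pi)).
    by apply: cvgMl_tmp; rewrite -[X in (_ --> X)%classic](@sqrtr0 R);
      exact: sqrt_continuous.
Unshelve. all: by end_near. Qed.

(** * A primitive of gamma in closed form *)

(** This is erfc(t^(-1/2)) / 2, the integral of gamma over [0, t] after the substitution u =
    s^(-1/2). In this form it only has to be differentiated. *)
Definition heat_kernel_cdf {R : realType} (t : R) : R :=
  if t <= 0 then 0
  else 2^-1 - (Num.sqrt pi)^-1 * integral0_gauss (t `^ (- 2^-1)).

Lemma heat_kernel_cdf_le0 {R : realType} (t : R) :
  t <= 0 -> heat_kernel_cdf t = 0.
Proof. by rewrite /heat_kernel_cdf => ->. Qed.

Lemma heat_kernel_cdf_gt0 {R : realType} (t : R) : 0 < t ->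
  heat_kernel_cdf t = 2^-1 - (Num.sqrt pi)^-1 * integral0_gauss (t `^ (- 2^-1)).
Proof. by move=> t0; rewrite /heat_kernel_cdf leNgt t0. Qed.

Lemma is_derive_heat_kernel_cdf {R : realType} (t : R) : 0 < t ->
  is_derive t 1 (@heat_kernel_cdf R) (heat_kernel t).
Proof.
move=> t0.
pose E := integral0_gauss \o (fun x : R => x `^ (- 2^-1)).
pose F : R -> R := cst 2^-1 - ((Num.sqrt pi)^-1 \*: E).
apply: (@near_eq_is_derive _ _ _ F).
  near=> x; rewrite heat_kernel_cdf_gt0//.
  by near: x; exact: lt_nbhsr.
have dE : is_derive t 1 E
    (gauss_fun (t `^ (- 2^-1)) * (- 2^-1 * t `^ (- 2^-1 - 1))).
  apply: is_derive1_comp; last exact: is_derive1_powR.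
  by apply: is_derive_integral0_gauss; exact: powR_gt0.
have dF := is_deriveB (is_derive_cst (2^-1 : R) t 1)
  (is_deriveZ (Num.sqrt pi)^-1 dE).
apply: (is_derive_eq dF).
(* Squaring t^(-1/2) turns the Gaussian into e^(-1/t); the inner derivative -t^(-3/2) / 2 supplies
   the remaining factors, and the minus signs cancel. *)
rewrite /heat_kernel /gauss_fun -powR_mulrn ?powR_ge0// -powRrM.
rewrite (_ : - 2^-1 * 2%:R = -1 :> R); last by field.
rewrite (_ : - 2^-1 - 1 = - (3 / 2) :> R); last by field.
rewrite powR_inv1 ?ltW// /GRing.scale/= invfM.
by ring.
Unshelve. all: by end_near. Qed.

Lemma continuous_heat_kernel_cdf {R : realType} :
  continuous (@heat_kernel_cdf R).
Proof.
have p0 : 0 < Num.sqrt pi :> R by rewrite sqrtr_gt0 pi_gt0.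
move=> t; have [t0|t0|->] := ltgtP t 0.
- rewrite /continuous_at (heat_kernel_cdf_le0 _ (ltW t0)).
  have : ((0 : R) @[_ --> t] --> (0 : R))%classic by exact: cvg_cst.
  apply: cvg_trans; apply: near_eq_cvg.
  near=> x; rewrite heat_kernel_cdf_le0// ltW//.
  by near: x; exact: lt_nbhsl.
- have [d _] := is_derive_heat_kernel_cdf _ t0.
  exact/differentiable_continuous/derivable1_diffP.
- apply/left_right_continuousP; split; rewrite (heat_kernel_cdf_le0 _ (lexx _)).
    have : ((0 : R) @[_ --> (0 : R)^'-] --> (0 : R))%classic by exact: cvg_cst.
    apply: cvg_trans; apply: near_eq_cvg.
    apply: filterS (nbhs_left_le (0 : R)) => x x0.
    by rewrite heat_kernel_cdf_le0.
  have : (2^-1 - (Num.sqrt pi)^-1 * integral0_gauss (x `^ (- 2^-1))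
      @[x --> (0 : R)^'+] --> (0 : R))%classic.
    (* As x -> 0+, x^(-1/2) tends to infinity, and the full Gaussian integral exactly cancels the
       1/2. *)
    rewrite [X in (_ --> X)%classic](_ : _ =
      2^-1 - (Num.sqrt pi)^-1 * (Num.sqrt pi / 2)); last first.
      by field; rewrite gt_eqF.
    apply: cvgB; first exact: cvg_cst.
    apply: cvgMl_tmp.
    apply: cvg_comp cvg_integral0_gauss.
    have : ((Num.sqrt x)^-1 @[x --> (0 : R)^'+] --> +oo)%classic.
      apply/cvgrVy.
        by apply: filterS (nbhs_right_gt (0 : R)) => x x0; rewrite sqrtr_gt0.
      apply: cvg_at_right_filter; rewrite -[X in (_ --> X)%classic](@sqrtr0 R).
      exact: sqrt_continuous.
    apply: cvg_trans; apply: near_eq_cvg.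
    apply: filterS (nbhs_right_gt (0 : R)) => x x0.
    by rewrite powRN powR12_sqrt// ltW.
  apply: cvg_trans; apply: near_eq_cvg.
  apply: filterS (nbhs_right_gt (0 : R)) => x x0.
  by rewrite heat_kernel_cdf_gt0.
Unshelve. all: by end_near. Qed.

Lemma integral_heat_kernel {R : realType} (c h : R) : 0 < h -> h <= c ->
  \int[mu]_(tau in `[0, h]) heat_kernel (c - tau) =
  heat_kernel_cdf c - heat_kernel_cdf (c - h).
Proof.
move=> h0 hc.
(* The extension is continuous also at argument 0, which is reached at [tau = h] when [h = c]. *)
transitivity (\int[mu]_(tau in `[0, h]) heat_kernel_pos (c - tau)).
  apply: eq_Rintegral => tau; rewrite inE/= in_itv/= => /andP[t0 th].
  case: (leP (c - tau) 0) => ct; last by rewrite heat_kernel_pos_gt0.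
  rewrite heat_kernel_pos_le0//.
  have -> : c - tau = 0.
    by apply/le_anti; rewrite ct subr_ge0 (le_trans th).
  (* Both kernels vanish at 0, since [powR] sends base 0 with a nonzero exponent to 0. *)
  rewrite /heat_kernel powR0; first by rewrite mulr0 mul0r.
  by rewrite oppr_eq0 mulf_neq0 ?invr_neq0.
have cB (x : R) : {for x, continuous (fun x => c - x)}.
  by apply: cvgB; [exact: cvg_cst|exact: cvg_id].
pose F (x : R) := - heat_kernel_cdf (c - x).
have cF : continuous F.
  move=> x; apply: cvgN.
  exact: (@continuous_comp _ _ _ (fun y : R => c - y) heat_kernel_cdf _ (cB x)
    (continuous_heat_kernel_cdf _)).
have dF (x : R) : x \in `]0, h[ -> is_derive x 1 F (heat_kernel_pos (c - x)).
  rewrite in_itv/= => /andP[x0 xh].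
  have cx : 0 < c - x by rewrite subr_gt0 (lt_le_trans xh).
  have d1 := is_deriveB (is_derive_cst c x 1) (is_derive_id x 1).
  have d2 := is_deriveN (@is_derive1_comp _ heat_kernel_cdf (cst c - id) x _ _
    (is_derive_heat_kernel_cdf _ cx) d1).
  apply: (is_derive_eq d2).
  by rewrite sub0r mulrN1 opprK heat_kernel_pos_gt0.
rewrite /Rintegral (@continuous_FTC2 _ _ F) //.
- by rewrite -EFinB/= /F subr0 opprK addrC.
- apply: continuous_subspaceT => x.
  exact: (@continuous_comp _ _ _ (fun y : R => c - y) heat_kernel_pos _ (cB x)
    (continuous_heat_kernel_pos _)).
- split.
  + by move=> x /dF[].
  + exact/cvg_at_right_filter/cF.
  + exact/cvg_at_left_filter/cF.
- by move=> x /dF[d <-]; rewrite derive1E.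
Qed.

(** * A Schur bound and the energy estimate *)

(** Weight -uv <= (u^2 + v^2) / 2 by the entries of [A] and sum: row sums multiply the squares of
    [x], column sums those of [y]. *)
Lemma schur_quadratic_form {R : realType} (n : nat) (A : 'M[R]_n) (m : R)
    (x y : 'cV[R]_n) :
  (forall j k, 0 <= A j k) ->
  (forall j, \sum_k A j k <= m) -> (forall k, \sum_j A j k <= m) ->
  - (\sum_j x j 0 * (A *m y) j 0) <=
  m / 2 * (\sum_j x j 0 ^+ 2 + \sum_j y j 0 ^+ 2).
Proof.
move=> A0 Ar Ac.
have -> : m / 2 * (\sum_j x j 0 ^+ 2 + \sum_j y j 0 ^+ 2) =
    \sum_j m * (x j 0 ^+ 2 / 2) + \sum_j m * (y j 0 ^+ 2 / 2).
  by rewrite mulrDr !mulr_sumr; congr (_ + _); apply: eq_bigr => j _; field.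
apply: (@le_trans _ _ (\sum_j (\sum_k A j k) * (x j 0 ^+ 2 / 2) +
                       \sum_k (\sum_j A j k) * (y k 0 ^+ 2 / 2))); last first.
  by apply: lerD; apply: ler_sum => j _; apply: ler_wpM2r => //;
    rewrite mulr_ge0 ?sqr_ge0// invr_ge0.
under [X in _ <= _ + X]eq_bigr do rewrite mulr_suml.
rewrite [X in _ <= _ + X]exchange_big/= -big_split/= -sumrN ler_sum// => j _.
rewrite mulr_suml -big_split/= mxE mulr_sumr -sumrN ler_sum// => k _.
have := A0 j k; have := sqr_ge0 (x j 0 + y k 0).
move: (A j k) (x j 0) (y k 0) => a u v h a0.
have := mulr_ge0 a0 h; nra.
Qed.

(** Here [A] stands for -V. AM-GM replaces Cauchy-Schwarz, so that the argument stays within sums of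
    squares. *)
Lemma l2norm_block_le {R : realType} (n : nat) (A : 'M[R]_n) (c : R)
    (fm fp sm sp : 'cV[R]_n) :
  0 < c -> (forall j k, 0 <= A j k) ->
  (forall j, \sum_k A j k <= 2^-1 - c) ->
  (forall k, \sum_j A j k <= 2^-1 - c) ->
  block_mx (- 2^-1)%:M (- A) (- A) (- 2^-1)%:M *m col_mx sm sp = col_mx fm fp ->
  l2norm (col_mx sm sp) <= c^-1 * l2norm (col_mx fm fp).
Proof.
move=> c0 A0 Ar Ac; rewrite mul_block_col => /eq_col_mx[em ep].
have h1 := schur_quadratic_form _ _ _ sm sp A0 Ar Ac.
have h2 := schur_quadratic_form _ _ _ sp sm A0 Ar Ac.
rewrite /l2norm !big_split_ord/=.
under eq_bigr do rewrite col_mxEu.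
under [X in _ + X]eq_bigr do rewrite col_mxEd.
under [X in _ <= _ * Num.sqrt (X + _)]eq_bigr do rewrite col_mxEu.
under [X in _ <= _ * Num.sqrt (_ + X)]eq_bigr do rewrite col_mxEd.
rewrite -[c^-1]gtr0_norm ?invr_gt0// -sqrtr_sqr -sqrtrM ?sqr_ge0//.
apply: ler_wsqrtr.
(* Pairing the equation with -2 s gives |s|^2 = -2 <s, A t> - 2 <s, f>; AM-GM with weight [c] splits
   the last term. *)
have energy (s f t : 'cV[R]_n) : (- 2^-1)%:M *m s + - A *m t = f ->
    \sum_j s j 0 ^+ 2 <= - 2 * \sum_j s j 0 * (A *m t) j 0
      + (c * \sum_j s j 0 ^+ 2 + c^-1 * \sum_j f j 0 ^+ 2).
  move=> <-; rewrite !mulr_sumr -!big_split/= ler_sum// => j _.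
  have -> : ((- 2^-1)%:M *m s + - A *m t) j 0 = - 2^-1 * s j 0 - (A *m t) j 0.
    by rewrite mul_scalar_mx mulNmx !mxE.
  move: (s j 0) ((A *m t) j 0) => u v.
  (* AM-GM: [- 2 u w <= c u^2 + w^2 / c] *)
  have := mulr_ge0 (ltW c0) (sqr_ge0 (u + c^-1 * (- 2^-1 * u - v))).
  set w := - 2^-1 * u - v.
  have -> : c * (u + c^-1 * w) ^+ 2 = c * u ^+ 2 + 2 * u * w + c^-1 * w ^+ 2.
    by field; rewrite gt_eqF.
  rewrite /w; nra.
have e1 := energy _ _ _ em.
have e2 : \sum_j sp j 0 ^+ 2 <= - 2 * \sum_j sp j 0 * (A *m sm) j 0
      + (c * \sum_j sp j 0 ^+ 2 + c^-1 * \sum_j fp j 0 ^+ 2).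
  by apply: energy; rewrite addrC.
move: (\sum_j sm j 0 ^+ 2) (\sum_j sp j 0 ^+ 2) (\sum_j fm j 0 ^+ 2)
  (\sum_j fp j 0 ^+ 2) h1 h2 e1 e2 => S1 S2 F1 F2 h1 h2 e1 e2.
(* With S = S1 + S2 and F = F1 + F2, the two Schur bounds give S <= (1 - 2c) S + c S + F / c. *)
have cS : c * (S1 + S2) <= c^-1 * (F1 + F2) by nra.
have -> : S1 + S2 = c^-1 * (c * (S1 + S2)) by rewrite mulKf// gt_eqF.
by rewrite expr2 -mulrA ler_pM2l ?invr_gt0.
Qed.

(** * The weights, and the row and column sums of -V *)

(** Up to sign, the weight is the mass of gamma on [l dt, (l + 1) dt], so sums of weights
    telescope. *)
Lemma euler_weight_heat_kernel_cdf {R : realType} (dt : R) (l : nat) : 0 < dt ->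
  - euler_weight dt l.+1 =
  heat_kernel_cdf (l.+1%:R * dt) - heat_kernel_cdf (l%:R * dt).
Proof.
move=> dt0; have le_dt : dt <= l.+1%:R * dt by rewrite ler_peMl ?(ltW dt0)// ler1n.
rewrite /euler_weight opprK (integral_heat_kernel _ _ dt0 le_dt).
congr (_ - heat_kernel_cdf _).
by rewrite -natr1 mulrDl mul1r addrK.
Qed.

Lemma oppr_euler_weight_ge0 {R : realType} (dt : R) (l : nat) :
  0 <= - euler_weight dt l.
Proof.
by rewrite opprK; apply: Rintegral_ge0 => tau _; exact: heat_kernel_ge0.
Qed.

Lemma heat_kernel_cdf_le {R : realType} (T t : R) : 1 <= T -> 0 < t -> t <= T ->
  heat_kernel_cdf t <= 2^-1 - (expR 1 * Num.sqrt (pi * T))^-1.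
Proof.
move=> T1 t0 tT; have T0 : 0 < T by exact: lt_le_trans T1.
rewrite heat_kernel_cdf_gt0// lerD2l lerN2 sqrtrM ?pi_ge0//.
rewrite mulrCA invfM ler_wpM2l ?invr_ge0 ?sqrtr_ge0//.
rewrite powRN powR12_sqrt ?(ltW t0)// [expR 1 * _]mulrC invfM.
(* Taken at y = T^(-1/2), which is at most 1 by [1 <= T] and at most t^(-1/2) by [t <= T]. *)
apply: integral0_gauss_ge_expN1.
- by rewrite invr_ge0 sqrtr_ge0.
- by rewrite invf_le1 ?sqrtr_gt0// -[leLHS]sqrtr1 ler_wsqrtr.
- by rewrite lef_pV2 ?posrE ?sqrtr_gt0// ler_wsqrtr.
Qed.

(** Extending the sum to N terms adds nonnegative quantities only, and the full sum telescopes to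
    the primitive at N dt. *)
Lemma sum_euler_weight_le {R : realType} (T : R) (N : nat) (dt : R) (n : nat) :
  1 <= T -> (1 <= N)%N -> 0 < dt -> N%:R * dt <= T -> (n <= N)%N ->
  \sum_(0 <= l < n) - euler_weight dt l.+1 <=
  2^-1 - (expR 1 * Num.sqrt (pi * T))^-1.
Proof.
move=> T1 N1 dt0 NT nN.
apply: (@le_trans _ _ (\sum_(0 <= l < N) - euler_weight dt l.+1)).
  rewrite [leRHS](big_cat_nat (n := n))//= lerDl sumr_ge0// => l _.
  exact: oppr_euler_weight_ge0.
rewrite (telescope_sumr_eq (fun l => heat_kernel_cdf (l%:R * dt)))//.
  rewrite mul0r [X in _ - X]heat_kernel_cdf_le0// subr0.
  by apply: heat_kernel_cdf_le => //; rewrite mulr_gt0// ltr0n.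
by move=> l _; exact: euler_weight_heat_kernel_cdf.
Qed.

Lemma row_sum_euler_mx {R : realType} (N : nat) (dt : R) (j : 'I_N.+1) :
  \sum_k (- euler_mx N dt) j k = \sum_(0 <= l < j) - euler_weight dt l.+1.
Proof.
pose F k := if (k < j)%N then - euler_weight dt (j - k)%N else 0.
transitivity (\sum_(0 <= k < N.+1) F k).
  rewrite big_mkord; apply: eq_bigr => k _.
  by rewrite !mxE /F; case: ifP => // _; rewrite oppr0.
rewrite (big_cat_nat (n := j))//=; last exact: ltnW.
rewrite [X in _ + X]big_nat_cond [X in _ + X]big1 ?addr0; last first.
  by move=> k /andP[/andP[jk _] _]; rewrite /F ltnNge jk.
(* Reversal sets k = j - 1 - l, so the lag j - k becomes l + 1. *)
rewrite big_nat_rev/= add0n; apply: eq_big_nat => l /andP[_ lj].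
by rewrite /F subnSK// leq_subr subKn.
Qed.

Lemma col_sum_euler_mx {R : realType} (N : nat) (dt : R) (k : 'I_N.+1) :
  \sum_j (- euler_mx N dt) j k = \sum_(0 <= l < N - k) - euler_weight dt l.+1.
Proof.
pose F j := if (k < j)%N then - euler_weight dt (j - k)%N else 0.
transitivity (\sum_(0 <= j < N.+1) F j).
  rewrite big_mkord; apply: eq_bigr => j _.
  by rewrite !mxE /F; case: ifP => // _; rewrite oppr0.
rewrite (big_cat_nat (n := k.+1))//=.
rewrite [X in X + _]big_nat_cond [X in X + _]big1 ?add0r; last first.
  by move=> j /andP[/andP[_ jk] _]; rewrite /F ltnNge -ltnS jk.
(* The shift j = l + k + 1 makes the lag l + 1 and leaves N - k terms. *)
rewrite -[k.+1]add0n big_addn subSS; apply: eq_bigr => l _.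
by rewrite /F addnS ltnS leq_addl subSn ?leq_addl// addnK.
Qed.

Theorem theorem3 (R : realType) (T : R) (hT : 1 <= T)
  (N : nat) (hN : (1 <= N)%N)
  (dt : R) (hdt : 0 < dt) (hNdt : N%:R * dt <= T)
  (fm fp sm sp : 'cV[R]_N.+1)
  (hfm0 : fm ord0 0 = 0) (hfp0 : fp ord0 0 = 0)
  (hsys : block_mx (- 2^-1)%:M (euler_mx N dt)
                   (euler_mx N dt) (- 2^-1)%:M *m col_mx sm sp
          = col_mx fm fp) :
  l2norm (col_mx sm sp) <= expR 1 * Num.sqrt (pi * T) * l2norm (col_mx fm fp).
Proof.
(* The constant is written as c^-1 with c = 1 / (e sqrt(pi T)), and the estimate is applied to -V,
   whose entries are nonnegative. *)
rewrite -[expR 1 * _]invrK.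
apply: (@l2norm_block_le _ _ (- euler_mx N dt)).
- by rewrite invr_gt0 mulr_gt0 ?expR_gt0// sqrtr_gt0 mulr_gt0 ?pi_gt0//
    (lt_le_trans _ hT).
- move=> j k; rewrite !mxE; case: ifP => _; last by rewrite oppr0.
  exact: oppr_euler_weight_ge0.
- move=> j; rewrite row_sum_euler_mx; apply: (@sum_euler_weight_le _ _ N) => //.
  by rewrite -ltnS.
- move=> k; rewrite col_sum_euler_mx; apply: (@sum_euler_weight_le _ _ N) => //.
  exact: leq_subr.
- by rewrite opprK.
Qed.
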